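(* Let $(D,\vdash,\dashv,\circ)$ be a di-skew brace, let $r$ be its associated solution, and write $r$ as the hemi-semidirect product of $r_G$ and $r_E$ via $(\psi,\sigma)$, where, for a fixed bar-unit $0\in E(D)$, $G=D\vdash 0$ (a group under $\vdash$), $E=E(D)$, and $\psi_g(e)=g^{-1}\vdash e\dashv g$, $\sigma_g(e)=\lambda_g(e)$ for $g\in G$, $e\in E$. Set $$m_\psi:=\inf\left\{h\in\mathbb{N}\mid \forall\, a,b\in G,\ \forall\, v\in E\quad (\psi_b\psi_a)^h\psi_b^{-h}(v)=v\right\}.$$ Then $r$ has finite order if and only if $G/Z(G)$ is periodic and $m_\psi$ is finite. In particular, when this happens, $r$ has even order and $o(r)=2\,\mathrm{lcm}\left(\exp(G/Z(G)),\,m_\psi\right)$.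
   Context: Here $\mathbb{N}$ is the set of positive integers, $\inf\emptyset=\infty$, $\exp$ denotes the exponent of a group, $Z(G)$ the centre, and $o(r)$ the order of $r$ as an element of $\mathrm{Sym}(D\times D)$. A disemigroup is a set $D$ with two associative binary operations $\vdash,\dashv$ such that $a\vdash(b\dashv c)=(a\vdash b)\dashv c$, $a\dashv(b\vdash c)=a\dashv(b\dashv c)$ and $(a\vdash b)\vdash c=(a\dashv b)\vdash c$ for all $a,b,c$. A bar-unit is an element $e\in D$ with $e\vdash a=a=a\dashv e$ for all $a\in D$; $E(D)$ denotes the set of bar-units. A $g$-digroup is a disemigroup with at least one bar-unit such that for every $a\in D$ and every bar-unit $e$ there is a unique pair $a^{I_e},a^{J_e}\in D$ with $a^{I_e}\dashv a=e=a\vdash a^{J_e}$. The elements $a^{I_e}\vdash b=a^{J_{e'}}\vdash b$ and $b\dashv a^{I_e}=b\dashv a^{J_{e'}}$ do not depend on the bar-units $e,e'$; they are written $a^{-1}\vdash b$ and $b\dashv a^{-1}$. For a bar-unit $0$, $G=D\vdash 0$ is a subgroup of $(D,\vdash)$ with identity $0$, and every $a\in D$ has a unique decomposition $a=g_a\vdash e_a$ with $g_a\in G$, $e_a\in E(D)$. A right group is a semigroup $(D,\circ)$ such that for all $a,b$ there is a unique $x$ with $a\circ x=b$; this $x$ is written $a^-\circ b$. A di-skew brace is a quadruple $(D,\vdash,\dashv,\circ)$ where $(D,\vdash,\dashv)$ is a $g$-digroup, $(D,\circ)$ is a right group, and for all $a,b,c$ (with $\circ$ having higher precedence): $a\circ(b\vdash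 c)=a\circ b\vdash a^{-1}\vdash a\circ c$, $\ a\circ(b\dashv c)=a\circ b\dashv a^{-1}\dashv a\circ c$, $\ (a\vdash b)\circ c=(a\dashv b)\circ c$. Its associated solution of the set-theoretic Yang--Baxter equation is the bijection $r(a,b)=(\lambda_a(b),(\lambda_a(b))^-\circ(a\dashv\lambda_a(b)))$ of $D\times D$, where $\lambda_a(b)=a^{-1}\vdash a\circ b$. Hemi-semidirect decomposition of $r$: with $a\bullet b:=(a\circ b)\vdash 0$, $(G,\vdash,\bullet)$ is a skew brace; put $\varphi_a(b)=\lambda_a(b)\vdash 0$ for $a,b\in G$, and let $r_G$ be the solution of this skew brace and $r_E$ the trivial solution on $E$. Identifying $D$ with $G\times E$ via $a\mapsto(g_a,e_a)$, $r$ becomes the solution $r((a,u),(b,v))=(\Lambda_{(a,u)}(b,v),\ \Lambda^{-1}_{\Lambda_{(a,u)}(b,v)}(\Lambda_{(a,u)}(b,v)\triangleright(a,u)))$ with $\Lambda_{(a,u)}(b,v)=(\varphi_a(b),\sigma_a(v))$ and $(a,u)\triangleright(b,v)=(a^{-1}\vdash b\vdash a,\ \psi_a(v))$, inverses being taken in the group $G$; this is the hemi-semidirect product of $r_G$ and $r_E$ via $(\psi,\sigma)$.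
   Formalization: ''Periodic'' is taken as periodic of finite exponent (with torsion only, the direct sum of all Sym(n) is a counterexample), and the evenness and formula for o(r) are stated only for D with at least two elements, since for |D|=1 the solution r is the identity, of order 1. *)

(* Defs.v *)
From mathcomp Require Import all_boot.
From Stdlib Require Import ClassicalEpsilon.

Set Implicit Arguments.
Unset Strict Implicit.
Unset Printing Implicit Defensive.

(* Elements of {1, 2, ...} \cup {oo} are encoded in [option nat], with [None]
   for oo.  [ninf P] is the infimum of {n >= 1 | P n}, with inf of the empty
   set equal to oo. *)
Definition is_ninf (P : nat -> Prop) (o : option nat) : Prop :=
  match o with
  | Some n => [/\ 0 < n, P n & forall k, 0 < k -> P k -> n <= k]
  | None => forall k, 0 < k -> ~ P k
  end.

Definition ninf (P : nat -> Prop) : option nat :=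
  epsilon (inhabits None) (is_ninf P).

Lemma ninfP (P : nat -> Prop) : is_ninf P (ninf P).
Proof.
apply: epsilon_spec.
case: (classic (exists n, 0 < n /\ P n)) => [[n [n0 Pn]]|nP]; last first.
  by exists None => k k0 Pk; apply: nP; exists k.
elim/ltn_ind: n n0 Pn => n IH n0 Pn.
case: (classic (exists k, [/\ k < n, 0 < k & P k])) => [[k [kn k0 Pk]]|nk].
  exact: (IH k).
exists (Some n); split=> // k k0 Pk; rewrite leqNgt; apply/negP => kn.
by apply: nk; exists k.
Qed.

(* The order of f as an element of Sym(T), for f a bijection of T. *)
Definition sym_order (T : Type) (f : T -> T) : option nat :=
  ninf (fun n => forall x, iter n f x = x).

Record threeOps := ThreeOps {
  carrier :> Type;
  vd : carrier -> carrier -> carrier;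
  dv : carrier -> carrier -> carrier;
  circ : carrier -> carrier -> carrier
}.

Notation "a ⊢ b" := (vd a b) (at level 45, left associativity).
Notation "a ⊣ b" := (dv a b) (at level 45, left associativity).
Notation "a ∘ b" := (circ a b) (at level 38, left associativity).

Section Definitions.
Variable D : threeOps.
Implicit Types a b c e g u v x y : D.

Definition disemigroup : Prop :=
  [/\ forall a b c, a ⊢ (b ⊢ c) = (a ⊢ b) ⊢ c,
      forall a b c, a ⊣ (b ⊣ c) = (a ⊣ b) ⊣ c,
      forall a b c, a ⊢ (b ⊣ c) = (a ⊢ b) ⊣ c,
      forall a b c, a ⊣ (b ⊢ c) = a ⊣ (b ⊣ c) &
      forall a b c, (a ⊢ b) ⊢ c = (a ⊣ b) ⊢ c].

Definition bar_unit e : Prop := forall a, e ⊢ a = a /\ a ⊣ e = a.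

Definition g_digroup : Prop :=
  [/\ disemigroup,
      exists e, bar_unit e &
      forall a e, bar_unit e ->
        exists! p : D * D, p.1 ⊣ a = e /\ e = a ⊢ p.2].

(* a^{I_e} for some bar-unit e.  It is only used in [inv a ⊢ b] and
   [b ⊣ inv a], which do not depend on e and may be computed with any a^{I_e}
   or a^{J_e}: see [inv_vd] and [dv_inv]. *)
Definition inv a : D :=
  epsilon (inhabits a) (fun x => exists2 e, bar_unit e & x ⊣ a = e).

Definition right_group : Prop :=
  (forall a b c, a ∘ (b ∘ c) = (a ∘ b) ∘ c) /\
  (forall a b, exists! x, a ∘ x = b).

(* a^- ∘ b *)
Definition rdiv a b : D := epsilon (inhabits a) (fun x => a ∘ x = b).

Definition di_skew_brace : Prop :=
  [/\ g_digroup,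
      right_group,
      forall a b c, a ∘ (b ⊢ c) = a ∘ b ⊢ inv a ⊢ a ∘ c,
      forall a b c, a ∘ (b ⊣ c) = a ∘ b ⊣ inv a ⊣ a ∘ c &
      forall a b c, (a ⊢ b) ∘ c = (a ⊣ b) ∘ c].

Definition lambda a b : D := inv a ⊢ a ∘ b.

Definition solution (p : D * D) : D * D :=
  let l := lambda p.1 p.2 in (l, rdiv l (p.1 ⊣ l)).

Section BarUnit.
Variable zero : D.

Definition inG g : Prop := exists a, g = a ⊢ zero.

(* The quotient G/Z(G): its elements are the cosets gZ(G), multiplied as
   subsets of G; its identity is Z(G). *)
Definition inZ z : Prop := inG z /\ forall g, inG g -> z ⊢ g = g ⊢ z.

Definition coset g : D -> Prop := fun x => exists2 z, inZ z & x = g ⊢ z.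

Definition set_mul (A B : D -> Prop) : D -> Prop :=
  fun x => exists a b, [/\ A a, B b & x = a ⊢ b].

Definition coset_pow g n : D -> Prop := iter n (set_mul (coset g)) inZ.

Definition coset_pow_trivial g n : Prop :=
  forall x, coset_pow g n x <-> inZ x.

Definition quotient_periodic : Prop :=
  forall g, inG g -> exists2 n, 0 < n & coset_pow_trivial g n.

Definition quotient_exponent : option nat :=
  ninf (fun n => forall g, inG g -> coset_pow_trivial g n).

(* For g in G these are maps from E(D) to itself; [psiV g] is the inverse of
   [psi g]: see [psi_bar_unit], [psiK] and [psiVK]. *)
Definition psi g e : D := inv g ⊢ e ⊣ g.
Definition psiV g e : D := g ⊢ e ⊣ inv g.

Definition sigma g e : D := lambda g e.
Definition phi a b : D := lambda a b ⊢ zero.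

Definition m_psi : option nat :=
  ninf (fun h => forall a b v, inG a -> inG b -> bar_unit v ->
    iter h (fun w => psi b (psi a w)) (iter h (psiV b) v) = v).

End BarUnit.
End Definitions.

Section GDigroup.
Variable D : threeOps.
Hypothesis DP : g_digroup D.
Implicit Types a b c e g h u v x y : D.

Lemma vdA a b c : a ⊢ (b ⊢ c) = a ⊢ b ⊢ c.
Proof. by case: DP => -[]. Qed.
Lemma dvA a b c : a ⊣ (b ⊣ c) = a ⊣ b ⊣ c.
Proof. by case: DP => -[]. Qed.
Lemma vddvA a b c : a ⊢ (b ⊣ c) = a ⊢ b ⊣ c.
Proof. by case: DP => -[]. Qed.
Lemma dv_vd a b c : a ⊣ (b ⊢ c) = a ⊣ (b ⊣ c).
Proof. by case: DP => -[]. Qed.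
Lemma vd_vd a b c : a ⊢ b ⊢ c = (a ⊣ b) ⊢ c.
Proof. by case: DP => -[]. Qed.

Lemma inv_spec a : exists2 e, bar_unit e & inv a ⊣ a = e.
Proof.
apply: (epsilon_spec (inhabits a)
  (fun x => exists2 e, bar_unit e & x ⊣ a = e)).
case: DP => _ [e eP] /(_ a e eP) [[x y] [[/= xa _] _]].
by exists x; exists e.
Qed.

Lemma right_inv a e : bar_unit e -> exists y, a ⊢ y = e.
Proof. by case: DP => _ _ H /H -/(_ a) [[x y] [[/= _ ay] _]]; exists y. Qed.

Lemma left_right_vd a b x y e e' : bar_unit e -> bar_unit e' ->
  x ⊣ a = e -> a ⊢ y = e' -> x ⊢ b = y ⊢ b.
Proof.
move=> eP e'P xa ay; rewrite -[in LHS](e'P b).1 -ay -vdA vdA vd_vd xa.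
exact: (eP _).1.
Qed.

Lemma left_right_dv a b x y e e' : bar_unit e -> bar_unit e' ->
  x ⊣ a = e -> a ⊢ y = e' -> b ⊣ x = b ⊣ y.
Proof.
move=> eP e'P xa ay; have bxa : b ⊣ x ⊣ a = b by rewrite -dvA xa (eP _).2.
by rewrite -[in RHS]bxa -dvA -dv_vd ay (e'P _).2.
Qed.

Lemma inv_vd a b x e : bar_unit e -> x ⊣ a = e \/ a ⊢ x = e ->
  inv a ⊢ b = x ⊢ b.
Proof.
have [f fP fa] := inv_spec a; move=> eP [] xa.
  have [y ay] := right_inv a eP.
  by rewrite (left_right_vd b fP eP fa ay) (left_right_vd b eP eP xa ay).
exact: left_right_vd fP eP fa xa.
Qed.

Lemma dv_inv a b x e : bar_unit e -> x ⊣ a = e \/ a ⊢ x = e ->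
  b ⊣ inv a = b ⊣ x.
Proof.
have [f fP fa] := inv_spec a; move=> eP [] xa.
  have [y ay] := right_inv a eP.
  by rewrite (left_right_dv b fP eP fa ay) (left_right_dv b eP eP xa ay).
exact: left_right_dv fP eP fa xa.
Qed.

Lemma vKl a b : inv a ⊢ (a ⊢ b) = b.
Proof. by have [e eP ea] := inv_spec a; rewrite vdA vd_vd ea (eP b).1. Qed.

Lemma vKr a b : a ⊢ (inv a ⊢ b) = b.
Proof.
have [e eP _] := inv_spec a; have [y ay] := right_inv a eP.
by rewrite (inv_vd b eP (or_intror ay)) vdA ay (eP b).1.
Qed.

Lemma dKr a b : b ⊣ inv a ⊣ a = b.
Proof. by have [e eP ea] := inv_spec a; rewrite -dvA ea (eP b).2. Qed.

Lemma dKl a b : b ⊣ a ⊣ inv a = b.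
Proof.
have [e eP _] := inv_spec a; have [y ay] := right_inv a eP.
by rewrite (dv_inv _ eP (or_intror ay)) -dvA -dv_vd ay (eP b).2.
Qed.

Lemma psiK g : cancel (psi g) (psiV g).
Proof. by move=> e; rewrite /psi /psiV vddvA vKr dKl. Qed.

Lemma psiVK g : cancel (psiV g) (psi g).
Proof. by move=> e; rewrite /psi /psiV vddvA vKl dKr. Qed.

Lemma psi_bar_unit g e : bar_unit e -> bar_unit (psi g e).
Proof.
move=> eP a; rewrite /psi; split.
  by rewrite -vd_vd -!vdA (eP _).1 vKl.
by rewrite -vddvA dv_vd !dvA (eP _).2 dKr.
Qed.

Lemma psiV_bar_unit g e : bar_unit e -> bar_unit (psiV g e).
Proof.
move=> eP a; rewrite /psiV; split.
  by rewrite -vd_vd -!vdA (eP _).1 vKr.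
by rewrite -vddvA dv_vd !dvA (eP _).2 dKl.
Qed.

End GDigroup.

Section DiSkewBrace.
Variable D : threeOps.
Hypothesis DP : di_skew_brace D.
Implicit Types a b c e g h u v x y : D.

Let gP : g_digroup D. Proof. by case: DP. Qed.

Lemma circ_rdiv a b : a ∘ rdiv a b = b.
Proof.
case: DP => _ [_ /(_ a b) [x [xP _]]] _ _ _.
by apply: (epsilon_spec (inhabits a) (fun x => a ∘ x = b)); exists x.
Qed.

Lemma rdiv_circ a b : rdiv a (a ∘ b) = b.
Proof.
have := circ_rdiv a (a ∘ b).
case: DP => _ [_ /(_ a (a ∘ b)) [x [_ xU]]] _ _ _ E.
by rewrite -(xU _ E) -(xU _ (erefl _)).
Qed.

Lemma solution_bij : bijective (@solution D).
Proof.
pose a_ (q : D * D) := q.1 ∘ q.2 ⊣ inv q.1.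
exists (fun q => (a_ q, rdiv (a_ q) (a_ q ⊢ q.1))) => -[a b].
  by rewrite /solution /a_ /= circ_rdiv dKl // /lambda vKr // rdiv_circ.
have aE : a_ (a, b) ⊣ a = a ∘ b by rewrite /a_ dKr.
rewrite /solution /=; move: (a_ _) aE => c cE.
by rewrite /lambda circ_rdiv vKl // cE rdiv_circ.
Qed.

(* The identification of D with G x E, and the hemi-semidirect decomposition of
   the solution; c, k are in G and z, w in E, and the two components of
   Lambda^{-1}_{(c, z)} are the inverses of phi_c and sigma_c. *)
Variable zero : D.
Hypothesis zeroP : bar_unit zero.

Lemma decomposition a : exists! p : D * D,
  [/\ inG zero p.1, bar_unit p.2 & a = p.1 ⊢ p.2].
Proof.
have aE : a ⊢ zero ⊢ (inv a ⊢ a) = a.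
  by rewrite -(vdA gP) (zeroP _).1 vKr.
exists (a ⊢ zero, inv a ⊢ a); split=> /=.
  split=> //; first by exists a.
  move=> x; split; first by rewrite -(vdA gP) vKl.
  by rewrite (dv_vd gP) (dvA gP) dKr.
case=> [_ e] /= [[g ->] eP ->].
have gE x : (g ⊢ zero ⊢ e) ⊢ x = g ⊢ x.
  by rewrite -!(vdA gP) (eP _).1 (zeroP _).1.
congr pair; first exact: gE.
rewrite -[RHS](vKl gP (g ⊢ zero ⊢ e)); congr vd.
by rewrite gE -!(vdA gP) (zeroP _).1.
Qed.

Lemma lambda_vdl g u b : bar_unit u -> lambda (g ⊢ u) b = lambda g b.
Proof.
move=> uP; case: DP => _ _ _ _ circl.
rewrite /lambda circl (uP g).2 -[RHS](vKl gP (g ⊢ u)); congr vd.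
by rewrite -(vdA gP) (uP _).1 vKr.
Qed.

Lemma lambda_vd a b c : lambda a (b ⊢ c) = lambda a b ⊢ lambda a c.
Proof. by case: DP => _ _ H _ _; rewrite /lambda H !(vdA gP). Qed.

Lemma lambda_dv a b c : lambda a (b ⊣ c) = lambda a b ⊣ lambda a c.
Proof.
by case: DP => _ _ _ H _; rewrite /lambda H (dv_vd gP) !(vddvA gP) (dvA gP).
Qed.

Lemma lambda_rdiv a b : lambda a (rdiv a (a ⊢ b)) = b.
Proof. by rewrite /lambda circ_rdiv vKl. Qed.

Lemma lambda_inj a : injective (lambda a).
Proof.
move=> b c /(congr1 (vd a)); rewrite /lambda !vKr // => /(congr1 (rdiv a)).
by rewrite !rdiv_circ.
Qed.

Lemma sigma_bar_unit g v : bar_unit v <-> bar_unit (sigma g v).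
Proof.
rewrite /sigma; split=> vP x.
  rewrite -(lambda_rdiv g x) -lambda_vd -lambda_dv.
  by rewrite (vP _).1 (vP _).2.
by split; apply: (@lambda_inj g); rewrite ?lambda_vd ?lambda_dv
  ?(vP _).1 ?(vP _).2.
Qed.

Lemma solution_hemi_semidirect g h u v :
    inG zero g -> inG zero h -> bar_unit u -> bar_unit v ->
  let c := phi zero g h in
  let z := sigma g v in
  [/\ inG zero c, bar_unit z &
  exists k w, [/\ inG zero k, bar_unit w,
    phi zero c k = inv c ⊢ g ⊢ c, sigma c w = psi c u &
    solution (g ⊢ u, h ⊢ v) = (c ⊢ z, k ⊢ w)]].
Proof.
move=> Gg Gh uP vP c z.
have zP : bar_unit z by apply: (proj1 (sigma_bar_unit g v)).
split=> //; first by exists (lambda g h).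
have cE : lambda g (h ⊢ v) = c ⊢ z.
  by rewrite lambda_vd /c /phi -(vdA gP) (zeroP _).1.
have [[k w] [/= [Gk wP kw] _]] :=
  decomposition (rdiv (c ⊢ z) ((g ⊢ u) ⊣ (c ⊢ z))).
exists k, w.
suff lam : phi zero c k ⊢ sigma c w = (inv c ⊢ g ⊢ c) ⊢ psi c u.
  have [P [_ PU]] := decomposition (phi zero c k ⊢ sigma c w).
  have E1 : P = (phi zero c k, sigma c w).
    apply: PU; split=> //=; first by exists (lambda c k).
    exact: (proj1 (sigma_bar_unit c w)).
  have E2 : P = (inv c ⊢ g ⊢ c, psi c u).
    apply: PU; split=> //=; last exact: psi_bar_unit.
    exists (inv c ⊢ g ⊢ c); rewrite -(vdA gP _ c zero).
    by congr (_ ⊢ _); rewrite /c /phi -(vdA gP) (zeroP _).1.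
  move: E2; rewrite E1 => -[e1 e2]; split=> //.
  by rewrite /solution /= lambda_vdl // cE kw.
have -> : phi zero c k ⊢ sigma c w = lambda (c ⊢ z) (k ⊢ w).
  by rewrite lambda_vdl // lambda_vd /phi -(vdA gP) (zeroP _).1.
rewrite -kw /lambda circ_rdiv.
have -> b : inv (c ⊢ z) ⊢ b = inv c ⊢ b.
  by rewrite -[RHS](vKl gP (c ⊢ z)) -(vdA gP) (zP _).1 vKr.
rewrite (dv_vd gP) (dvA gP) (zP _).2 /psi !(vddvA gP); congr dv.
by rewrite -(vdA gP _ c) vKr // (vdA gP).
Qed.

End DiSkewBrace.

(* Main.v *)
From mathcomp Require Import all_boot.
Require Import Defs.

(** The map (a, b) |-> (a, lambda_a b) is a bijection of D x D which conjugates
    the solution to s (a, b) = (b, psi_b a), where psi_b x = b^-1 ⊢ x ⊣ b now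
    acts on all of D ([lambda_graph_solution]).  The operation psi is a rack:
    each psi_b is bijective and psi_c psi_b = psi_(psi_c b) psi_c.  So only the
    inner structure of the g-digroup matters, and circ disappears.

    In a rack let the twist be theta a = psi_a^-1 a.  It commutes with every
    psi_c, and psi_(theta a) = psi_a; hence with W = psi_b psi_a one gets
    s^2 (a, b) = (W (theta a), W (theta b)), and the W of this new pair is again
    W.  Iterating, s^(2n) (a, b) = (W^n (theta^n a), W^n (theta^n b))
    ([iter_double_rack_braiding]), with theta^n a = psi_a^-n a.

    In a g-digroup psi_b psi_a = psi_(a ⊢ b) and bar-units act trivially.  It
    follows that s^(2n) = 1 exactly when psi_x^n = 1 for all x in D: for the
    direct implication, take b a bar-unit, so that theta b = b and W = psi_a,
    to see that psi_a^n fixes the bar-units; and read the first component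
    modulo E, where theta is trivial, to see that psi_x^n is trivial modulo E
    ([iter_double_psi_braiding]).  The psi_x are automorphisms of (D, ⊢) and
    every element is a product of one in G and one in E, so psi_x^n = 1 splits
    into the two conditions that psi_x^n is trivial modulo E, which says that
    the n-th powers of G are central ([central_power_quotient]), and that it is
    trivial on E.  The latter is equivalent to the condition that defines m_psi:
    with b = 0 that condition reads psi_a^h = 1 on E, and conversely psi_b psi_a
    is itself some psi_c ([fixing_power_m_psi]).  Each condition holds exactly
    for the multiples of its least positive solution, so together they hold for
    the multiples of the lcm.

    Finally, an odd power of s can be the identity only if D has one element:
    its first component would exhibit every a as the image of the bar-unit 0
    under some psi's, so every element would be a bar-unit, and then s would be
    the flip ([psi_braiding_even]). *)

Set Implicit Arguments.
Unset Strict Implicit.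
Unset Printing Implicit Defensive.

(** * Infima of sets of exponents *)

(** What makes P the set of multiples of one number: it holds for the n such
    that the n-th powers of certain maps are trivial. *)
Definition exponent_set (P : nat -> Prop) : Prop :=
  P 0 /\ forall m n, P m -> (P (m + n) <-> P n).

Lemma exponent_set_dvdn (P : nat -> Prop) n :
  exponent_set P -> ninf P = Some n -> 0 < n /\ forall k, P k <-> n %| k.
Proof.
move=> [P0 PD] Pn; have := ninfP P; rewrite Pn /= => -[n_gt0 nP n_min].
have PMD q r : P (q * n + r) <-> P r.
  by elim: q => [|q IHq] //; rewrite mulSn -addnA PD.
split=> // k; rewrite {1}(divn_eq k n) PMD /dvdn.
split=> [Pr|/eqP-> //]; rewrite eqn0Ngt; apply/negP => r_gt0.
by have := n_min _ r_gt0 Pr; rewrite leqNgt ltn_pmod.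
Qed.

Lemma ninf_dvdn (P : nat -> Prop) n :
  0 < n -> (forall k, P k <-> n %| k) -> ninf P = Some n.
Proof.
move=> n_gt0 Pn; have := ninfP P; case: (ninf P) => [k [k_gt0 /Pn nk k_min]|].
  congr Some; apply: anti_leq; rewrite (dvdn_leq k_gt0 nk) andbT.
  by apply: k_min => //; apply/Pn.
by move=> /(_ n n_gt0) []; apply/Pn.
Qed.

Lemma eq_ninf (P Q : nat -> Prop) :
  (forall n, P n <-> Q n) -> ninf P = ninf Q.
Proof.
move=> PQ; have := ninfP P; have := ninfP Q.
case: (ninf P) (ninf Q) => [m|] [n|] //=.
- move=> [n_gt0 Qn n_min] [m_gt0 Pm m_min]; congr Some; apply: anti_leq.
  by rewrite m_min ?n_min //; apply/PQ.
- by move=> noQ [m_gt0 /PQ Qm _]; case: (noQ m).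
- by move=> [n_gt0 /PQ Pn _] noP; case: (noP n).
Qed.

Lemma ninf_finite (P : nat -> Prop) :
  ninf P <> None <-> exists2 n, 0 < n & P n.
Proof.
have := ninfP P; case: (ninf P) => [n [n_gt0 Pn _]|noP].
  by split=> // _; exists n.
by split=> // -[n n_gt0 Pn]; case: (noP n).
Qed.

(** * The braiding of a rack *)

Definition rack_braiding T (act : T -> T -> T) (p : T * T) : T * T :=
  (p.2, act p.2 p.1).

Section Rack.

Variables (T : Type) (act actV : T -> T -> T).
Hypothesis actK : forall a, cancel (act a) (actV a).
Hypothesis actVK : forall a, cancel (actV a) (act a).
Hypothesis act_act :
  forall c b a, act c (act b a) = act (act c b) (act c a).
Implicit Types a b c x : T.

Definition twist a := actV a a.

Lemma act_twistK a : act a (twist a) = a.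
Proof. exact: actVK. Qed.

(** Since a = act a (twist a), the inner maps satisfy act a = act (act a (twist
    a)), which is act (twist a) conjugated by act a; cancel act a. *)
Lemma act_twist a x : act (twist a) x = act a x.
Proof. by apply: (can_inj (actK a)); rewrite act_act act_twistK. Qed.

(** The twist is defined from the rack operation and its inverses, and each
    act b is an automorphism of the rack. *)
Lemma twist_act b a : twist (act b a) = act b (twist a).
Proof.
by apply: (can_inj (actK (act b a))); rewrite act_twistK -act_act act_twistK.
Qed.

Lemma act_iter_twist n a x : act (iter n twist a) x = act a x.
Proof. by elim: n => //= n IHn; rewrite act_twist. Qed.

(** As all the iterates of the twist at a act like a, the n-th iterate is the
    inverse of the n-th power of act a, applied to a. *)
Lemma iter_act_twistK n a : iter n (act a) (iter n twist a) = a.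
Proof.
by elim: n => // n IHn; rewrite iterSr iterS -(act_iter_twist n) act_twistK.
Qed.

(** The square of the braiding applies W \o twist to both components and keeps W
    unchanged, as W' = W W W^-1. *)
Lemma iter_double_rack_braiding n a b :
  let W x := act b (act a x) in
  iter n.*2 (rack_braiding act) (a, b) =
    (iter n W (iter n twist a), iter n W (iter n twist b)).
Proof.
elim: n a b => [//|n IHn] a b W.
have itW y : iter n twist (W y) = W (iter n twist y).
  by elim: n {IHn} => //= n ->; rewrite /W !twist_act.
have step : rack_braiding act (rack_braiding act (a, b)) =
    (W (twist a), W (twist b)).
  by rewrite /rack_braiding /W /= act_twistK act_act act_twistK.
have E x : act (W (twist b)) (act (W (twist a)) x) = W x.
  have -> : W (twist b) = act (act b a) b.
    by rewrite /W act_act act_twistK.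
  by rewrite /W act_twistK -!act_act.
by rewrite doubleS !iterSr step IHn /= !(eq_iter E) !itW.
Qed.

End Rack.

(** * Inner automorphisms of a g-digroup *)

Section Inner.

Variable D : threeOps.
Hypothesis DP : g_digroup D.
Implicit Types a b c u v x y : D.

Lemma vd_inj a : injective (vd a).
Proof. exact: can_inj (vKl DP a). Qed.

Lemma psi_vdl b a x : psi b (psi a x) = psi (a ⊢ b) x.
Proof.
have invM y : inv (a ⊢ b) ⊢ y = inv b ⊢ (inv a ⊢ y).
  by apply: (@vd_inj (a ⊢ b)); rewrite vKr // -(vdA DP a) !vKr.
by rewrite /psi invM (dv_vd DP) (dvA DP) !(vddvA DP).
Qed.

Lemma psi_dvl b a x : psi (a ⊣ b) x = psi (a ⊢ b) x.
Proof.
rewrite /psi (dv_vd DP); congr (_ ⊣ _); apply: (@vd_inj (a ⊢ b)).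
by rewrite vKr // (vd_vd DP) vKr.
Qed.

(** Self-distributivity: both sides are the action of a product, and
    c ⊢ psi c b = b ⊣ c acts like b ⊢ c. *)
Lemma psi_rack c b a : psi c (psi b a) = psi (psi c b) (psi c a).
Proof.
have cE : c ⊢ psi c b = b ⊣ c by rewrite /psi (vddvA DP) vKr.
by rewrite !psi_vdl cE psi_dvl.
Qed.

Lemma psi_vd c x y : psi c (x ⊢ y) = psi c x ⊢ psi c y.
Proof.
rewrite /psi !(vddvA DP) -(vd_vd DP) -!(vdA DP).
by rewrite vKr.
Qed.

Lemma psi_unit v x : bar_unit v -> psi v x = x.
Proof.
by move=> vP; rewrite /psi (vP _).2; apply: (@vd_inj v); rewrite vKr // (vP _).1.
Qed.

Lemma psi_vd_unit a v x : bar_unit v -> psi (a ⊢ v) x = psi a x.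
Proof. by move=> vP; rewrite -psi_vdl psi_unit. Qed.

Lemma iter_twist_unit n v : bar_unit v -> iter n (twist (@psiV D)) v = v.
Proof.
move=> vP; elim: n => //= n ->.
by rewrite /twist -[RHS](psiK DP v) psi_unit.
Qed.

Lemma iter_psi_vd n c x y :
  iter n (psi c) (x ⊢ y) = iter n (psi c) x ⊢ iter n (psi c) y.
Proof. by elim: n => //= n ->; rewrite psi_vd. Qed.

Lemma iter_psi_bar_unit n c v : bar_unit v -> bar_unit (iter n (psi c) v).
Proof. by move=> vP; elim: n => //= n IHn; apply: psi_bar_unit. Qed.

Lemma inv_vd_bar_unit a : bar_unit (inv a ⊢ a).
Proof.
move=> x; split; first by rewrite -(vdA DP) vKl.
by rewrite (dv_vd DP) (dvA DP) dKr.
Qed.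

Variable zero : D.
Hypothesis zeroP : bar_unit zero.

Lemma vd_zero_vd a x : a ⊢ zero ⊢ x = a ⊢ x.
Proof. by rewrite -(vdA DP) (zeroP _).1. Qed.

Lemma decomposeE a : a ⊢ zero ⊢ (inv a ⊢ a) = a.
Proof. by rewrite vd_zero_vd vKr. Qed.

(** The maps psi c need not preserve G, as they may move zero to another
    bar-unit; but they are compatible with the projection of D onto G along E. *)
Lemma iter_psi_vd_zero n c x y :
  x ⊢ zero = y ⊢ zero ->
  iter n (psi c) x ⊢ zero = iter n (psi c) y ⊢ zero.
Proof.
move=> xy; have v0 := iter_psi_bar_unit n c zeroP.
rewrite -[in LHS](v0 zero).1 -[in RHS](v0 zero).1 !(vdA DP).
by rewrite -!iter_psi_vd xy.
Qed.

(** Conjugation by a fixes the component of a in G. *)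
Lemma twist_vd_zero a : twist (@psiV D) a ⊢ zero = a ⊢ zero.
Proof.
apply: (@vd_inj (inv a)).
by rewrite /twist /psiV -(vd_vd DP) -!(vdA DP) !vKl // vKr.
Qed.

Lemma iter_twist_vd_zero n a : iter n (twist (@psiV D)) a ⊢ zero = a ⊢ zero.
Proof. by elim: n => //= n IHn; rewrite twist_vd_zero. Qed.

(** * Exponents *)

(** The action of psi^n on the first factor of D = G x E is trivial; this is the
    form in which centrality of the n-th powers of G comes out of the solution,
    with x and y ranging over D rather than G. *)
Definition central_power n : Prop :=
  forall x y, iter n (psi x) y ⊢ zero = y ⊢ zero.

(** The corresponding condition on the factor E. *)
Definition fixing_power n : Prop :=
  forall x v, bar_unit v -> iter n (psi x) v = v.

Lemma central_power_exponent_set : exponent_set central_power.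
Proof.
split=> // m n Pm.
by split=> P x y; have := P x y; rewrite iterD Pm.
Qed.

Lemma fixing_power_exponent_set : exponent_set fixing_power.
Proof.
split=> // m n Pm; split=> P x v vP; have := P x v vP;
  by rewrite iterD Pm //; apply: iter_psi_bar_unit.
Qed.

Lemma iter_psi_id n :
  (forall x y, iter n (psi x) y = y) <-> central_power n /\ fixing_power n.
Proof.
split=> [id_n | [cen fix_] x y].
  by split=> [x y|x v _]; rewrite id_n.
rewrite -[in LHS](decomposeE y) iter_psi_vd.
rewrite (fix_ _ (inv y ⊢ y)); last exact: inv_vd_bar_unit.
rewrite -vd_zero_vd cen.
by rewrite -(vdA DP y) (zeroP _).1 decomposeE.
Qed.

(** The hypothesis at a pair (a, b) says that psi_(a ⊢ b)^n undoes the n-fold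
    twist on a and on b; both conditions come from choosing the pair well. *)
Lemma iter_double_psi_braiding n :
  (forall p, iter n.*2 (rack_braiding (@psi D)) p = p) <->
  central_power n /\ fixing_power n.
Proof.
have br := iter_double_rack_braiding (psiK DP) (psiVK DP) psi_rack n.
split=> [id_n | /iter_psi_id id_n [a b]]; last first.
  have tw a' : iter n (twist (@psiV D)) a' = a'.
    rewrite -[LHS](id_n a').
    exact: (iter_act_twistK (psiK DP) (psiVK DP) psi_rack).
  by rewrite br !(eq_iter (psi_vdl b a)) !tw !id_n.
have {}br a b : (iter n (psi (a ⊢ b)) (iter n (twist (@psiV D)) a),
    iter n (psi (a ⊢ b)) (iter n (twist (@psiV D)) b)) = (a, b).
  by rewrite -[RHS]id_n br !(eq_iter (psi_vdl b a)).
split=> [x y | x v vP].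
  (* The pair is chosen so that psi_(a ⊢ b) is psi x and the first entry is y. *)
  have [+ _] := br y (inv y ⊢ x); rewrite vKr // => E.
  rewrite -[in RHS]E; apply: iter_psi_vd_zero.
  by rewrite iter_twist_vd_zero.
have [_] := br x v.
by rewrite iter_twist_unit // (eq_iter (fun y => psi_vd_unit x y vP)).
Qed.

(** * The centre of G *)

Lemma inGE g : inG zero g -> g ⊢ zero = g.
Proof. by move=> [a ->]; rewrite vd_zero_vd. Qed.

Lemma inG_vd g a : inG zero a -> inG zero (g ⊢ a).
Proof. by move=> Ga; exists (g ⊢ a); rewrite -(vdA DP) inGE. Qed.

Lemma inG_zero : inG zero zero.
Proof. by exists zero; rewrite (zeroP _).1. Qed.

Lemma inG_pow g n : inG zero (iter n (vd g) zero).
Proof. by elim: n => [|n IHn]; [exact: inG_zero | exact: inG_vd]. Qed.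

Lemma inZ_zero : inZ zero zero.
Proof. by split=> [|g Gg]; [exact: inG_zero | rewrite (zeroP _).1 inGE]. Qed.

Lemma inZ_vd y z : inZ zero y -> inZ zero z -> inZ zero (y ⊢ z).
Proof.
move=> [Gy yC] [Gz zC]; split=> [|g Gg]; first exact: inG_vd.
by rewrite -(vdA DP) zC // (vdA DP) yC // -(vdA DP).
Qed.

Lemma inZ_inv_vd y z : inZ zero y -> inZ zero z -> inZ zero (inv y ⊢ z).
Proof.
move=> [Gy yC] [Gz zC]; split=> [|g Gg]; first exact: inG_vd.
apply: (@vd_inj y).
by rewrite -(vdA DP) vKr // zC // !(vdA DP) yC // -!(vdA DP) vKr.
Qed.

(** Central factors can be collected on the right; [iter n (vd g) zero] is the
    power g^n in G. *)
Lemma coset_powE g n x :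
  inG zero g -> coset_pow zero g n x <-> coset zero (iter n (vd g) zero) x.
Proof.
move=> Gg; rewrite /coset_pow; elim: n x => [|n IHn] x /=.
  split=> [Zx|[z Zz ->]]; last by rewrite (zeroP z).1.
  by exists x => //; rewrite (zeroP x).1.
split=> [[_ [_ [[y Zy ->] /IHn[z Zz ->] ->]]] | [z Zz ->]].
  exists (y ⊢ z); first exact: inZ_vd.
  by rewrite -(vdA DP) (vdA DP y) Zy.2 -?(vdA DP) //; exact: inG_pow.
exists g, (iter n (vd g) zero ⊢ z); split; last by rewrite (vdA DP).
  by exists zero; [exact: inZ_zero | rewrite inGE].
by apply/IHn; exists z.
Qed.

Lemma coset_pow_trivialE g n :
  inG zero g -> coset_pow_trivial zero g n <-> inZ zero (iter n (vd g) zero).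
Proof.
move=> Gg; split=> [triv | Zgn x].
  apply/triv/coset_powE => //; exists zero; first exact: inZ_zero.
  by rewrite inGE //; exact: inG_pow.
rewrite coset_powE //; split=> [[z Zz ->]|Zx]; first exact: inZ_vd.
by exists (inv (iter n (vd g) zero) ⊢ x); [exact: inZ_inv_vd | rewrite vKr].
Qed.

(** For z in G, psi z y projects to z^-1 y z in G, and the projections of the y
    in D exhaust G. *)
Lemma inZ_psi z :
  inG zero z -> inZ zero z <-> forall y, psi z y ⊢ zero = y ⊢ zero.
Proof.
move=> Gz.
have psiE y : psi z y ⊢ zero = inv z ⊢ (y ⊢ z).
  by rewrite /psi -(vd_vd DP) -(vdA DP) inGE // (vdA DP).
split=> [[_ zC] y | zC].
  by rewrite psiE -(vd_zero_vd y z) -zC ?vKl //; exists y.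
split=> // g Gg; rewrite -[in RHS](vKr DP z (g ⊢ z)).
by rewrite -psiE zC inGE.
Qed.

Lemma iter_psi_pow g n y : iter n (psi g) y = psi (iter n (vd g) zero) y.
Proof.
elim: n y => [|n IHn] y; first by rewrite psi_unit.
by rewrite iterSr IHn psi_vdl.
Qed.

Lemma central_power_quotient n :
  (forall g, inG zero g -> coset_pow_trivial zero g n) <-> central_power n.
Proof.
split=> [triv x y | cen g Gg].
  rewrite -(eq_iter (fun y => psi_vd_unit x y zeroP)) iter_psi_pow.
  have Gx : inG zero (x ⊢ zero) by exists x.
  by move: y; apply/inZ_psi; [exact: inG_pow | apply/coset_pow_trivialE/triv].
apply/coset_pow_trivialE => //; apply/inZ_psi; first exact: inG_pow.
by move=> y; rewrite -iter_psi_pow cen.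
Qed.

(** In the left-hand condition b = zero removes the inverse power; conversely
    psi_b psi_a = psi_(a ⊢ b), so the power of this product is trivial on E, and
    so is that of psi_b. *)
Lemma fixing_power_m_psi n :
  (forall a b v, inG zero a -> inG zero b -> bar_unit v ->
     iter n (fun w => psi b (psi a w)) (iter n (psiV b) v) = v) <->
  fixing_power n.
Proof.
split=> [fix_ x v vP | fix_ a b v Ga Gb vP].
  have Gx : inG zero (x ⊢ zero) by exists x.
  have := fix_ _ _ v Gx inG_zero vP.
  have -> : iter n (psiV zero) v = v.
    by elim: (n) => //= k ->; rewrite -[LHS](psi_unit _ zeroP) psiVK.
  rewrite (eq_iter (psi_vdl _ _)).
  by rewrite inGE // (eq_iter (fun y => psi_vd_unit x y zeroP)).
rewrite (eq_iter (psi_vdl b a)).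
have vVP k : bar_unit (iter k (psiV b) v).
  by elim: k => //= k IHk; apply: psiV_bar_unit.
rewrite fix_ // -(fix_ b _ (vVP n)).
by elim: (n) => // k IHk; rewrite iterSr /= psiVK.
Qed.

(** If an odd power of the braiding is the identity, every a is obtained from an
    arbitrary b by twists and inner maps.  With b = zero this makes a a bar-unit;
    then all inner maps and twists are trivial, and a = b for all a and b. *)
Lemma psi_braiding_even n :
  (exists x y : D, x <> y) ->
  (forall p, iter n (rack_braiding (@psi D)) p = p) -> ~~ odd n.
Proof.
move=> [x [y xy]] id_n; apply/negP => odd_n; apply: xy; set k := n./2.
have br a b : iter k (psi (b ⊢ psi b a)) (iter k (twist (@psiV D)) b) = a.
  have := id_n (a, b); rewrite -[n]odd_double_half odd_n iterSr.
  rewrite (iter_double_rack_braiding (psiK DP) (psiVK DP) psi_rack) => -[+ _].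
  by rewrite (eq_iter (psi_vdl _ _)).
have unit a : bar_unit a.
  by rewrite -[a](br a zero) iter_twist_unit //; apply: iter_psi_bar_unit.
rewrite -[LHS](br x y) iter_twist_unit //.
by elim: (k) => //= m ->; rewrite psi_unit.
Qed.

End Inner.

(** * The associated solution *)

Section Solution.

Variable D : threeOps.
Hypothesis DP : di_skew_brace D.

Let gP : g_digroup D. Proof. by case: DP. Qed.

(** The first component is kept and b is replaced by lambda_a b; this is the
    guitar map in degree two, which takes a solution to its derived solution. *)
Definition lambda_graph (p : D * D) : D * D := (p.1, lambda p.1 p.2).

Lemma lambda_graph_solution p :
  lambda_graph (solution p) = rack_braiding (@psi D) (lambda_graph p).
Proof.
rewrite /lambda_graph /solution /rack_braiding /=; congr pair.
by rewrite /lambda circ_rdiv // (vddvA gP).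
Qed.

Lemma iter_solution_id n :
  (forall p, iter n (@solution D) p = p) <->
  (forall p, iter n (rack_braiding (@psi D)) p = p).
Proof.
have graphK : cancel lambda_graph (fun q => (q.1, rdiv q.1 (q.1 ⊢ q.2))).
  by case=> a b; rewrite /lambda_graph /= /lambda vKr // rdiv_circ.
have graphVK : cancel (fun q => (q.1, rdiv q.1 (q.1 ⊢ q.2))) lambda_graph.
  by case=> a b; rewrite /lambda_graph /= lambda_rdiv.
have iterE p : lambda_graph (iter n (@solution D) p) =
    iter n (rack_braiding (@psi D)) (lambda_graph p).
  by elim: n => //= n <-; rewrite lambda_graph_solution.
split=> id_n p; first by rewrite -[p]graphVK -iterE id_n.
by apply: (can_inj graphK); rewrite iterE id_n.
Qed.

End Solution.

Theorem corollary4p11 (D : threeOps) (zero : D) :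
  di_skew_brace D -> bar_unit zero ->
  (sym_order (@solution D) <> None <->
   [/\ quotient_periodic zero,
       quotient_exponent zero <> None &
       m_psi zero <> None]) /\
  ((exists x y : D, x <> y) -> sym_order (@solution D) <> None ->
   exists k n m : nat,
     [/\ sym_order (@solution D) = Some k,
         ~~ odd k,
         quotient_exponent zero = Some n,
         m_psi zero = Some m &
         k = 2 * lcmn n m]).
Proof.
move=> DP zeroP; have gP : g_digroup D by case: DP.
have expE := eq_ninf (central_power_quotient gP zeroP).
have mE := eq_ninf (fixing_power_m_psi gP zeroP).
rewrite -/(quotient_exponent zero) in expE; rewrite -/(m_psi zero) in mE.
have double_id k : (forall p, iter k.*2 (@solution D) p = p) <->
    central_power zero k /\ fixing_power D k.
  apply: iff_trans (iter_solution_id DP _) _.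
  exact: iter_double_psi_braiding.
have fin : sym_order (@solution D) <> None <->
    exists n m, quotient_exponent zero = Some n /\ m_psi zero = Some m.
  rewrite /sym_order ninf_finite expE mE; split.
    move=> [k k_gt0 id_k].
    have /double_id [cen fix_] : forall p, iter k.*2 (@solution D) p = p.
      by move=> p; rewrite -addnn iterD !id_k.
    case En: (ninf (central_power zero)) => [n|]; last first.
      by case: (proj2 (ninf_finite (central_power zero))); first by exists k.
    case Em: (ninf (fixing_power D)) => [m|]; last first.
      by case: (proj2 (ninf_finite (fixing_power D))); first by exists k.
    by exists n, m.
  move=> [n [m [En Em]]].
  have [n_gt0 nP] := exponent_set_dvdn (central_power_exponent_set zero) En.
  have [m_gt0 mP] := exponent_set_dvdn (fixing_power_exponent_set gP) Em.
  exists (lcmn n m).*2; first by rewrite double_gt0 lcmn_gt0 n_gt0.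
  apply/double_id; split; first by apply/nP; exact: dvdn_lcml.
  by apply/mP; exact: dvdn_lcmr.
split.
  rewrite fin; split=> [[n [m [En Em]]]|[_]]; last first.
    case: (quotient_exponent zero) => // n _.
    by case: (m_psi zero) => // m _; exists n, m.
  rewrite En Em; split=> // g Gg.
  have [n_gt0 nP] := exponent_set_dvdn (central_power_exponent_set zero)
    (etrans (esym expE) En).
  have /(central_power_quotient gP zeroP) triv : central_power zero n.
    by apply/nP.
  by exists n => //; apply: triv.
move=> nontrivial /fin [n [m [En Em]]]; exists (2 * lcmn n m), n, m.
split; rewrite ?mul2n ?odd_double //.
move: En Em; rewrite expE mE => En Em.
have [n_gt0 nP] := exponent_set_dvdn (central_power_exponent_set zero) En.
have [m_gt0 mP] := exponent_set_dvdn (fixing_power_exponent_set gP) Em.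
apply: ninf_dvdn => [|k]; first by rewrite double_gt0 lcmn_gt0 n_gt0.
have even_id : (forall p, iter k (@solution D) p = p) -> ~~ odd k.
  by move=> /(iter_solution_id DP); apply: psi_braiding_even.
case odd_k : (odd k) even_id => even_id.
  split=> [/even_id //|/dvdn_odd]; rewrite odd_double.
  by move=> /(_ odd_k).
have kE : k = k./2.*2 by rewrite -[LHS]odd_double_half odd_k.
rewrite kE double_id nP mP -!muln2 dvdn_pmul2r // dvdn_lcm.
by split=> [[-> ->]|/andP].
Qed.
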